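(* Assume $Y\subset\mathbb R^d$ is convex and closed and the functions $f_i,\widehat F_i:Y\to\mathbb R$, $i\in\mathcal I_0$, are all convex and continuous. Given $\delta^\circ,\delta>0$, let $x_{-\delta^\circ}\in X_{-\delta^\circ}$. Fix $\epsilon\ge f(x_{-\delta^\circ})-f^*$ and $\epsilon_0>0$, and let $\hat\epsilon:=\widehat F(x_{-\delta^\circ})-\widehat F^*+\epsilon_0$. If the following three conditions hold: $$\forall i\in\mathcal I:\quad \widehat\Delta_i(x_{-\delta^\circ})\le\delta^\circ;$$ $$\forall i\in\mathcal I:\quad \inf_{x\in X^{*,\epsilon}_{\delta,\mathrm{act}(i)}\cap\widehat X^{*,\hat\epsilon}}\widehat\Delta_i(x)>-\delta;$$ $$\inf_{x\in X_\delta^{*,=\epsilon}\cap\widehat X^{*,\hat\epsilon}}\widehat\Delta_0(x;x_{-\delta^\circ})>-\big(\epsilon-(f(x_{-\delta^\circ})-f^* )-\epsilon_0\big),$$ then: 1. $\widehat X^{*,\epsilon_0}\subset X_\delta^{*,\epsilon}$, i.e. any $x\in\widehat X$ with $\widehat F(x)\le\widehat F^*+\epsilon_0$ satisfies $x\in Y$, $\max_{i\in\mathcal I}f_i(x)\le\delta$ and $f(x)\le f^*+\epsilon$; 2. $|\widehat F^*-f^*|\le|\widehat\Delta_0(x^* )|+\sup_{x\in X_\delta^{*,\epsilon}}|\widehat\Delta_0(x;x^* )|+\max\{\epsilon,\mathrm{gap}(\delta)\}$.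
   Context: This is a deterministic statement. $\mathcal I$ is a finite index set, $0\notin\mathcal I$, $\mathcal I_0=\mathcal I\cup\{0\}$; $f_i,\widehat F_i:Y\to\mathbb R$ ($i\in\mathcal I_0$) are given functions; $f:=f_0$, $\widehat F:=\widehat F_0$. $X_\delta:=\{x\in Y:f_i(x)\le\delta\ \forall i\in\mathcal I\}$ for $\delta\in\mathbb R$, $X:=X_0\ne\emptyset$; $f^*:=\min_Xf$, assumed attained, $x^*\in X$ a fixed minimizer; $f^*_\delta:=\inf_{X_\delta}f$; $\mathrm{gap}(\delta):=|f_\delta^*-f^*|$. $X_\delta^{*,\vartheta}:=\{x\in X_\delta:f(x)\le f^*+\vartheta\}$; $X_\delta^{*,=\vartheta}:=\{x\in X_\delta:f(x)=f^*+\vartheta\}$; $X_{\delta,\mathrm{act}(i)}:=\{x\in X_\delta:f_i(x)=\delta\}$; $X_{\delta,\mathrm{act}(i)}^{*,\vartheta}:=X_\delta^{*,\vartheta}\cap X_{\delta,\mathrm{act}(i)}$. $\widehat X:=\{x\in Y:\widehat F_i(x)\le0\ \forall i\in\mathcal I\}$; $\widehat F^*:=\min_{\widehat X}\widehat F$, assumed attained; $\widehat X^{*,\vartheta}:=\{x\in\widehat X:\widehat F(x)\le\widehat F^*+\vartheta\}$. $\widehat\Delta_i(x):=\widehat F_i(x)-f_i(x)$ and $\widehat\Delta_i(y;x):=\widehat\Delta_i(y)-\widehat\Delta_i(x)$. The infimum over an empty set is $+\infty$. *)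

(* Defs.v *)
From HB Require Import structures.
From mathcomp Require Import all_boot all_order all_algebra.
From mathcomp Require Import all_classical all_reals all_analysis.

Set Implicit Arguments.
Unset Strict Implicit.
Unset Printing Implicit Defensive.

Import Order.TTheory GRing.Theory Num.Theory.
Import numFieldNormedType.Exports.

Local Open Scope classical_set_scope.
Local Open Scope ring_scope.

(* The index set I_0, that is I with an extra element 0, is [option I]:
   [None] is the objective index 0 and [Some i] is the constraint index i.
   A family of functions Y -> R indexed by I_0 is a family [g] of total functions
   on R^d, of which only the values on [Y] are ever used.
   Each notion below is defined for an arbitrary family [g]; it is instantiated
   both with the family f_i and with the family \hat F_i. *)

Definition feasible (R : realType) (d : nat) (I : finType)
    (Y : set 'rV[R]_d) (g : option I -> 'rV[R]_d -> R) (delta : R) :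
    set 'rV[R]_d :=
  [set x | Y x /\ forall i : I, g (Some i) x <= delta].

Definition is_minimizer (R : realType) (T : Type) (h : T -> R) (A : set T)
    (x : T) : Prop :=
  A x /\ forall y, A y -> h x <= h y.

(* The minimal value f^*, resp. \hat F^*, of the objective over the unrelaxed
   feasible set. [inf] is the real-valued infimum, which is meaningful because
   the minimum is always assumed to be attained. *)
Definition opt_value (R : realType) (d : nat) (I : finType)
    (Y : set 'rV[R]_d) (g : option I -> 'rV[R]_d -> R) : R :=
  inf [set g None x | x in feasible Y g 0].

(* X_delta^{*,theta}; note that the reference value is the optimal value at
   relaxation level 0, not delta. Taking delta = 0 for the family \hat F_i
   gives \hat X^{*,theta}. *)
Definition near_opt (R : realType) (d : nat) (I : finType)
    (Y : set 'rV[R]_d) (g : option I -> 'rV[R]_d -> R) (delta theta : R) :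
    set 'rV[R]_d :=
  [set x | feasible Y g delta x /\ g None x <= opt_value Y g + theta].

(* X_delta^{*,=theta} *)
Definition near_opt_eq (R : realType) (d : nat) (I : finType)
    (Y : set 'rV[R]_d) (g : option I -> 'rV[R]_d -> R) (delta theta : R) :
    set 'rV[R]_d :=
  [set x | feasible Y g delta x /\ g None x = opt_value Y g + theta].

(* X_{delta,act(i)} *)
Definition active (R : realType) (d : nat) (I : finType)
    (Y : set 'rV[R]_d) (g : option I -> 'rV[R]_d -> R) (delta : R) (i : I) :
    set 'rV[R]_d :=
  [set x | feasible Y g delta x /\ g (Some i) x = delta].

(* X_{delta,act(i)}^{*,theta} *)
Definition near_opt_active (R : realType) (d : nat) (I : finType)
    (Y : set 'rV[R]_d) (g : option I -> 'rV[R]_d -> R) (delta theta : R)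
    (i : I) : set 'rV[R]_d :=
  near_opt Y g delta theta `&` active Y g delta i.

(* f^*_delta need not be attained and may be infinite. *)
Definition relaxed_value (R : realType) (d : nat) (I : finType)
    (Y : set 'rV[R]_d) (g : option I -> 'rV[R]_d -> R) (delta : R) : \bar R :=
  ereal_inf [set (g None x)%:E | x in feasible Y g delta].

Definition gap (R : realType) (d : nat) (I : finType)
    (Y : set 'rV[R]_d) (g : option I -> 'rV[R]_d -> R) (delta : R) : \bar R :=
  `| relaxed_value Y g delta - (opt_value Y g)%:E |%E.

(* \hat Delta_i(x) *)
Definition err (R : realType) (d : nat) (I : finType)
    (f F : option I -> 'rV[R]_d -> R) (i : option I) (x : 'rV[R]_d) : R :=
  F i x - f i x.

(* \hat Delta_i(y; x) *)
Definition err_incr (R : realType) (d : nat) (I : finType)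
    (f F : option I -> 'rV[R]_d -> R) (i : option I) (y x : 'rV[R]_d) : R :=
  err f F i y - err f F i x.

(* Main.v *)
(* If a near-optimal point y of the approximate problem were not in
   X_delta^{*,eps}, then on the segment from x_{-delta0} to y there would be a
   point z of X_delta^{*,eps} at which either some constraint f_i is active or
   f equals f^* + eps. By convexity of the hat F_i, z is feasible for the
   approximate problem and hat F(z) <= hat F(x_{-delta0}) + eps0, which
   contradicts the corresponding lower bound on the error at z. The bound on the
   values follows by applying the inclusion to a minimizer of hat F. *)

Require Import Defs.
From HB Require Import structures.
From mathcomp Require Import all_boot all_order all_algebra.
From mathcomp Require Import all_classical all_reals all_analysis.
From mathcomp Require Import ring lra.

Import Order.TTheory GRing.Theory Num.Theory.
Import numFieldNormedType.Exports.

Local Open Scope classical_set_scope.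
Local Open Scope ring_scope.

Section segments.
Context {R : realType} {V : normedModType R}.
Implicit Types (Y : set V) (x y : V) (t : {i01 R}).
Local Open Scope convex_scope.

(** Convexity bounds the left side by a weighted mean of [h y] and [h x], which cannot exceed the
    larger one. *)
Lemma convex_function_le_max {Y} {h : V -> R} {x y} t :
  convex_function Y h -> Y x -> Y y ->
  h ((y : convex_lmodType V) <| t |> x) <= Num.max (h y) (h x).
Proof.
move=> hc Yx Yy; apply: le_trans (hc t _ _ (mem_set Yy) (mem_set Yx)) _.
have [yx|xy] := leP (h y) (h x); first exact: conv_le.
by rewrite convC conv_le// ltW.
Qed.

Lemma continuous_maxr : continuous (fun p : R * R => Num.max p.1 p.2).
Proof.
by move=> p; apply: continuous_max; [exact: cvg_fst | exact: cvg_snd].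
Qed.

(* The maximum of the finitely many [h j] is continuous along the segment, so
   the intermediate value theorem gives a point where it vanishes. The seed -1
   of the maximum only has to be negative, so that the value 0 is attained by
   some [h j]. *)
Lemma segment_crossing Y (J : finType) (h : J -> V -> R) x y :
  convex_set Y -> (forall j, {within Y, continuous (h j)}) ->
  Y x -> Y y -> (forall j, h j x <= 0) -> (exists j, 0 < h j y) ->
  exists t, let z := (y : convex_lmodType V) <| t |> x in
    (forall j, h j z <= 0) /\ exists j, h j z = 0.
Proof.
move=> cY hc Yx Yy hx [j0 hy].
pose z (s : R) : V := s *: y + (1 - s) *: x.
pose m (s : R) : R := \big[Num.max/-1]_j h j (z s).
have zE s (s0 : 0 <= s) (s1 : s <= 1) :
  z s = (y : convex_lmodType V) <| Itv01 s0 s1 |> x by [].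
(* Each [h j] is continuous only within [Y], so composing with [z] needs the segment to stay in
   [Y]. *)
have Yz s : `[0, 1]%classic s -> Y (z s).
  rewrite /= in_itv/= => /andP[s0 s1]; rewrite zE.
  by apply/set_mem/cY; exact/mem_set.
have zc : continuous z.
  move=> s; apply: cvgD; (apply: cvgZ; last exact: cvg_cst).
    exact: cvg_id.
  by apply: cvgB; [exact: cvg_cst | exact: cvg_id].
have mc : {within `[0, 1], continuous m}.
  apply/subspace_continuousP => s s01.
  apply: (cvg_big continuous_maxr (Ff := fun j r => h j (z r))) => j _.
  have /subspace_continuousP/(_ _ (Yz _ s01)) := hc j.
  apply: cvg_comp => B; rewrite /within/= => YB.
  apply: (@filterS _ (nbhs s) _ _ _ _ (zc s _ YB)) => r /= rB r01.
  exact/rB/Yz.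
have m0 : m 0 <= 0.
  by apply: bigmax_le => // j _; rewrite /z scale0r add0r subr0 scale1r.
have m1 : 0 < m 1.
  apply: lt_le_trans (le_bigmax _ _ j0).
  by rewrite /z subrr scale0r addr0 scale1r.
have [|s] := @IVT _ m 0 1 0 ler01 mc.
  by rewrite ge_min m0 le_max (ltW m1) orbT.
rewrite in_itv/= => /andP[s0 s1] ms; exists (Itv01 s0 s1); rewrite -zE/=.
have hz j : h j (z s) <= 0 by rewrite -ms; exact: le_bigmax.
split=> //; apply: contrapT => hz0.
suff : m s < 0 by rewrite ms ltxx.
apply/bigmax_ltP; split=> // j _; rewrite lt_neqAle hz andbT.
by apply/eqP => hj; apply: hz0; exists j.
Qed.
End segments.

(** The minimizer supplies both the nonemptiness and the lower bound that the real [inf]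
    requires. *)
Lemma opt_valueE {R : realType} {d} {I : finType} {Y : set 'rV[R]_d}
    {g : option I -> 'rV[R]_d -> R} {x} :
  is_minimizer (g None) (feasible Y g 0) x -> opt_value Y g = g None x.
Proof.
move=> [Xx gx]; apply/le_anti/andP; split.
  apply: ge_inf; last by exists x.
  by exists (g None x) => _ [y Xy <-]; exact: gx.
apply: lb_le_inf; first by exists (g None x), x.
by move=> _ [y Xy <-]; exact: gx.
Qed.


Theorem proposition5 (R : realType) (d : nat) (I : finType)
    (Y : set 'rV[R]_d) (f F : option I -> 'rV[R]_d -> R)
    (Y_convex : convex_set Y) (Y_closed : closed Y)
    (f_convex : forall i : option I, convex_function Y (f i))
    (F_convex : forall i : option I, convex_function Y (F i))
    (f_cont : forall i : option I, {within Y, continuous (f i)})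
    (F_cont : forall i : option I, {within Y, continuous (F i)})
    (xstar : 'rV[R]_d)
    (xstar_min : is_minimizer (f None) (feasible Y f 0) xstar)
    (F_min : exists x : 'rV[R]_d, is_minimizer (F None) (feasible Y F 0) x)
    (delta0 delta : R) (delta0_gt0 : 0 < delta0) (delta_gt0 : 0 < delta)
    (x0 : 'rV[R]_d) (x0_feasible : feasible Y f (- delta0) x0)
    (eps eps0 : R) (eps_ge : f None x0 - opt_value Y f <= eps)
    (eps0_gt0 : 0 < eps0)
    (epshat : R) (epshatE : epshat = F None x0 - opt_value Y F + eps0)
    (err_x0 : forall i : I, err f F (Some i) x0 <= delta0)
    (err_act : forall i : I,
      ((- delta)%:E <
       ereal_inf [set (err f F (Some i) x)%:E
                 | x in near_opt_active Y f delta eps i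
                        `&` near_opt Y F 0 epshat])%E)
    (err_obj :
      ((- (eps - (f None x0 - opt_value Y f) - eps0))%:E <
       ereal_inf [set (err_incr f F None x x0)%:E
                 | x in near_opt_eq Y f delta eps
                        `&` near_opt Y F 0 epshat])%E) :
  near_opt Y F 0 eps0 `<=` near_opt Y f delta eps /\
  (`|opt_value Y F - opt_value Y f|%:E <=
     `|err f F None xstar|%:E
     + ereal_sup [set `|err_incr f F None x xstar|%:E
                 | x in near_opt Y f delta eps]
     + Order.max eps%:E (gap Y f delta))%E.
Proof.
have fstar := opt_valueE xstar_min.
have [xh xh_min] := F_min.
have Fstar := opt_valueE xh_min.
have [Yx0 fx0] := x0_feasible.
have Xhx0 : feasible Y F 0 x0.
  split=> // i; have := err_x0 i; have := fx0 i; rewrite /err; lra.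
have Fx0 : opt_value Y F <= F None x0 by rewrite Fstar; exact: xh_min.2.
have sub : near_opt Y F 0 eps0 `<=` near_opt Y f delta eps.
  move=> y [[Yy Fy] Fy0]; apply: contrapT => ny.
  (* With these thresholds, [near_opt Y f delta eps] consists of the points of [Y] where every
     [f i - b i] is nonpositive, so constraints and objective are treated by a single crossing
     argument. *)
  pose b (i : option I) := if i is Some _ then delta else opt_value Y f + eps.
  have [|||t [fz [j fzj]]] :=
    segment_crossing Y _ (fun i x => f i x - b i) x0 y Y_convex _ Yx0 Yy.
  - move=> i; apply/subspace_continuousP => x Yx.
    apply: cvgB; last exact: cvg_cst.
    by have /subspace_continuousP := f_cont i; exact.
  - by case=> [i|] /=; [have := fx0 i; lra | lra].
  - apply: contrapT => le_b; apply: ny.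
    have {}le_b i : f i y <= b i.
      by rewrite leNgt; apply/negP => bf; apply: le_b; exists i; rewrite subr_gt0.
    by split; [split=> // i; exact: (le_b (Some i)) | exact: (le_b None)].
  set z := conv t _ _ in fz fzj.
  have Yz : Y z by apply/set_mem/Y_convex; exact/mem_set.
  have Fz i : F i z <= Num.max (F i y) (F i x0).
    exact: convex_function_le_max _ (F_convex i) Yx0 Yy.
  have Xz : near_opt Y f delta eps z.
    split; first by split=> // i; have := fz (Some i); rewrite /= subr_le0.
    by have := fz None; rewrite /= subr_le0.
  have Fz0 : F None z <= F None x0 + eps0.
    apply: (le_trans (Fz None)); rewrite ge_max; apply/andP; split; lra.
  have FzC i : F (Some i) z <= 0.
    by apply: (le_trans (Fz _)); rewrite ge_max Fy Xhx0.2.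
  have Xhz : near_opt Y F 0 epshat z by split=> //; rewrite epshatE; lra.
  (* An active constraint gives an error of at most [0 - delta] at [z], against [err_act]. *)
  move/eqP: fzj; rewrite subr_eq0 => /eqP; case: j => [i|] /= fzj.
    have : - delta < err f F (Some i) z.
      rewrite -lte_fin; apply: (lt_le_trans (err_act i)).
      apply: ereal_inf_lbound; exists z => //; split=> //; split=> //.
      by split=> //; exact: Xz.1.
    by have := FzC i; rewrite /err; lra.
  (* Here [f None z = opt_value Y f + eps]; subtracting this from [Fz0] bounds the error increment
     from above by exactly the left side. *)
  have : - (eps - (f None x0 - opt_value Y f) - eps0) <
      err_incr f F None z x0.
    rewrite -lte_fin; apply: (lt_le_trans err_obj).
    by apply: ereal_inf_lbound; exists z => //; split=> //; split=> //; exact: Xz.1.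
  by rewrite /err_incr /err; lra.
split=> //.
have Xxh : near_opt Y f delta eps xh.
  by apply: sub; split; [exact: xh_min.1 | rewrite Fstar; lra].
have Fdecomp : opt_value Y F - opt_value Y f =
    err f F None xstar + err_incr f F None xh xstar + (f None xh - opt_value Y f).
  by rewrite Fstar fstar /err_incr /err; ring.
rewrite Fdecomp.
apply: (@le_trans _ _ (`|err f F None xstar|%:E +
  `|err_incr f F None xh xstar|%:E + `|f None xh - opt_value Y f|%:E)%E).
  rewrite -!EFinD lee_fin; apply: (le_trans (ler_normD _ _)).
  by rewrite lerD2r ler_normD.
apply: leeD; first by apply: leeD => //; apply: ereal_sup_ubound; exists xh.
(* Since [xh] is feasible only for the relaxed problem, its objective may fall below the optimal
   value, but by at most the gap; any excess is at most [eps]. *)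
rewrite le_max; have [f_le|f_ge] := leP (f None xh) (opt_value Y f).
  apply/orP; right; rewrite /gap.
  have : (relaxed_value Y f delta <= (f None xh)%:E)%E.
    by apply: ereal_inf_lbound; exists xh => //; exact: Xxh.1.
  (* A relaxed value of [-oo] makes the gap [+oo]; the value [+oo] contradicts the upper bound. *)
  case: (relaxed_value Y f delta) => [r| |] //=; last by rewrite leey.
  rewrite !lee_fin => r_le; rewrite !ler0_norm; lra.
apply/orP; left; rewrite lee_fin gtr0_norm; have := Xxh.2; lra.
Qed.
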